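(* Let $G$ be a non-archimedean Polish group. Then $G$ is amenable if and only if every continuous action of $G$ on the Cantor set $D^{\aleph_0}=\{0,1\}^{\aleph_0}$ admits an invariant Borel probability measure.
   Context: A Polish group is a topological group whose topology is separable and completely metrizable. A topological group is non-archimedean if it is Hausdorff and has a base of neighbourhoods of the identity element consisting of open subgroups. A continuous action of a topological group $G$ on a topological space $X$ is a group action for which the map $G\times X\to X$, $(g,x)\mapsto gx$, is jointly continuous. A topological group $G$ is called amenable if every continuous action of $G$ on a (nonempty) compact Hausdorff space $X$ admits an invariant (regular) Borel probability measure, i.e. a Borel probability measure $\mu$ on $X$ with $\mu(g^{-1}A)=\mu(A)$ for all $g\in G$ and all Borel $A\subseteq X$. *)

(* Defs.v *)
From HB Require Import structures.
From mathcomp Require Import all_boot all_order all_algebra.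
From mathcomp Require Import all_classical all_reals all_analysis.

Set Implicit Arguments.
Unset Strict Implicit.
Unset Printing Implicit Defensive.

Import Order.TTheory GRing.Theory Num.Theory.

Local Open Scope classical_set_scope.
Local Open Scope ring_scope.

HB.mixin Record Topological_Group_isTopologicalGroup G
    & Topological G & Group G := {
  mulg_continuous : continuous (fun p : G * G => (p.1 * p.2)%g);
  invg_continuous : continuous (fun g : G => g^-1%g)
}.

(* Groups are written multiplicatively and need not be abelian, unlike in
   topologicalZmodType. *)
#[short(type="topologicalGroupType")]
HB.structure Definition TopologicalGroup :=
  {G of Topological G & Group G
      & Topological_Group_isTopologicalGroup G}.

#[short(type="completeMetricType")]
HB.structure Definition CompleteMetric (R : numDomainType) :=
  {M of Metric R M & CompletePseudoMetric R M}.

Definition homeomorphic (S T : topologicalType) : Prop :=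
  exists (f : S -> T) (f' : T -> S),
    [/\ continuous f, continuous f', cancel f f' & cancel f' f].

Definition separable_space (T : topologicalType) : Prop :=
  exists2 D : set T, countable D & dense D.

(* Since completeMetricType is pointed, this excludes the empty space. *)
Definition completely_metrizable (R : realType) (T : topologicalType) : Prop :=
  exists M : completeMetricType R, homeomorphic T M.

Definition polish (R : realType) (T : topologicalType) : Prop :=
  separable_space T /\ completely_metrizable R T.

Definition non_archimedean (G : topologicalGroupType) : Prop :=
  hausdorff_space G /\
  forall U : set G, nbhs (1%g : G) U ->
    exists H : set G, [/\ open H, group_closed [in H] & H `<=` U].

Definition continuous_action (G : topologicalGroupType) (X : topologicalType)
    (act : G -> X -> X) : Prop :=
  [/\ forall x, act 1%g x = x,
      forall g h x, act (g * h)%g x = act g (act h x) &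
      continuous (fun p : G * X => act p.1 p.2)].

Notation borel X := (g_sigma_algebraType (@open X)).

(* On a compact Hausdorff space compact sets are closed, hence Borel. *)
Definition regular_measure (R : realType) (X : ptopologicalType)
    (mu : probability (borel X) R) : Prop :=
  forall A : set (borel X), measurable A ->
    mu A = ereal_inf [set mu U | U in [set U : set X | open U /\ A `<=` U]] /\
    mu A = ereal_sup [set mu K | K in [set K : set X | compact K /\ K `<=` A]].

Definition invariant_measure (R : realType) (G : topologicalGroupType)
    (X : ptopologicalType) (act : G -> X -> X)
    (mu : probability (borel X) R) : Prop :=
  forall (g : G) (A : set (borel X)), measurable A ->
    mu (act g^-1%g @` A) = mu A.

(* Nonemptiness of X is provided by its structure of pointed space. *)
Definition amenable (R : realType) (G : topologicalGroupType) : Prop :=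
  forall (X : ptopologicalType) (act : G -> X -> X),
    compact [set: X] -> hausdorff_space X -> continuous_action act ->
    exists mu : probability (borel X) R,
      regular_measure mu /\ invariant_measure act mu.

(* Main.v *)
Require Import Defs.
From HB Require Import structures.
From mathcomp Require Import all_boot all_order all_algebra.
From mathcomp Require Import all_classical all_reals all_analysis.
From mathcomp Require Import lra.

Set Implicit Arguments.
Unset Strict Implicit.
Unset Printing Implicit Defensive.

Import Order.TTheory GRing.Theory Num.Theory.
Import numFieldNormedType.Exports.

Local Open Scope classical_set_scope.
Local Open Scope ring_scope.

(** For the nontrivial direction, let [m] be a finitely additive probability on
    the algebra of the sets [A] of elements of [G] whose stabilizer under left
    translation is open, and assume that [m] is invariant under left
    translation. If [G] acts on a compact Hausdorff space [X] with base point
    [x0], then [K |-> inf m A], where [A] ranges over the sets of this algebra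
    that contain [{g | g x0 \in U}] for some open neighbourhood [U] of [K], is
    an invariant content on the closed sets of [X], and extends to an invariant
    regular Borel probability. Additivity on disjoint closed sets is where small
    open subgroups of [G] are needed.

    To obtain [m], it suffices by compactness to work with a countable
    translation-invariant family [I] of such sets; since [G] is separable, every
    set with an open stabilizer lies in such an [I]. The [{0,1}]-valued functions
    on [I] that are additive and map [setT] to 1 form a compact metrizable
    zero-dimensional [G]-space. Its product with a Cantor set on which [G] acts
    trivially is a Cantor set, and an invariant probability on it gives each
    member of [I] a mass. *)

(** * Separation of closed sets in compact Hausdorff spaces *)

Lemma compact_hausdorff_shrink (X : topologicalType) (K U : set X) :
  compact [set: X] -> hausdorff_space X -> closed K -> open U -> K `<=` U ->
  exists V, [/\ open V, K `<=` V & closure V `<=` U].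
Proof.
move=> cX hX cK oU KU.
have : filter_from (set_nbhs K) closure U.
  by apply: (compact_normal hX cX cK); apply/set_nbhsP; exists U; split.
move=> [B /set_nbhsP[V [oV KV VB]] BU]; exists V; split => //.
by apply: subset_trans BU; exact: closureS.
Qed.

Lemma compact_hausdorff_separate (X : topologicalType) (K L : set X) :
  compact [set: X] -> hausdorff_space X -> closed K -> closed L ->
  K `&` L = set0 ->
  exists U V, [/\ open U, open V, K `<=` U, L `<=` V & U `&` V = set0].
Proof.
move=> cX hX cK cL KL.
have [||V [oV KV VL]] := @compact_hausdorff_shrink X K (~` L) cX hX cK.
- exact: closed_openC.
- exact/disjoints_subset.
exists V, (~` closure V); split => //.
- exact/closed_openC/closed_closure.
- by move=> x Lx Vx; exact: VL Vx Lx.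
- by apply/disjoints_subset; rewrite setCK; exact: subset_closure.
Qed.

(** * From a content on closed sets to a regular Borel probability *)

Section content_measure.
Context (R : realType) (X : ptopologicalType).
Hypotheses (cX : compact [set: X]) (hX : hausdorff_space X).
Variable lam : set X -> R.
Hypothesis lam0 : lam set0 = 0.
Hypothesis lamT : lam setT = 1.
Hypothesis lam_mono :
  forall K L, closed K -> closed L -> K `<=` L -> lam K <= lam L.
Hypothesis lam_sub :
  forall K L, closed K -> closed L -> lam (K `|` L) <= lam K + lam L.
Hypothesis lam_add : forall K L, closed K -> closed L -> K `&` L = set0 ->
  lam K + lam L <= lam (K `|` L).

Local Open Scope ereal_scope.

(* Halmos' extension of a content on closed sets to a regular Borel measure. *)
Definition inner_content (U : set X) : \bar R :=
  ereal_sup [set (lam K)%:E | K in [set K : set X | closed K /\ K `<=` U]].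

Definition content_ext (A : set X) : \bar R :=
  ereal_inf [set inner_content U | U in [set U : set X | open U /\ A `<=` U]].

Lemma lam_le1 K : closed K -> (lam K <= 1)%R.
Proof. by move=> cK; rewrite -lamT; apply: lam_mono => //; exact: closedT. Qed.

Lemma le_inner_content U V : U `<=` V -> inner_content U <= inner_content V.
Proof.
move=> UV; apply: ereal_sup_le => _ [K [cK KU] <-].
by exists K => //; split => //; exact: subset_trans KU UV.
Qed.

Lemma inner_content_ub K U : closed K -> K `<=` U ->
  (lam K)%:E <= inner_content U.
Proof. by move=> cK KU; apply: ereal_sup_ubound; exists K. Qed.

Lemma inner_content_ge0 U : 0 <= inner_content U.
Proof.
have := @inner_content_ub set0 U closed0 (@sub0set _ _).
by rewrite lam0.
Qed.

Lemma inner_content_le1 U : inner_content U <= 1.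
Proof. by apply: ge_ereal_sup => _ [K [cK _] <-]; rewrite lee_fin lam_le1. Qed.

Lemma inner_contentT : inner_content setT = 1.
Proof.
apply/eqP; rewrite eq_le inner_content_le1/=.
by have := @inner_content_ub setT setT closedT (@subsetT _ _); rewrite lamT.
Qed.

Lemma content_ext_ub A U : open U -> A `<=` U ->
  content_ext A <= inner_content U.
Proof. by move=> oU AU; apply: ereal_inf_lbound; exists U. Qed.

Lemma content_ext_open U : open U -> content_ext U = inner_content U.
Proof.
move=> oU; apply/eqP; rewrite eq_le content_ext_ub//=.
by apply: le_ereal_inf_tmp => _ [V [oV UV] <-]; exact: le_inner_content.
Qed.

Lemma content_ext_ge0 A : 0 <= content_ext A.
Proof.
by apply: le_ereal_inf_tmp => _ [V [oV UV] <-]; exact: inner_content_ge0.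
Qed.

Lemma content_ext_le1 A : content_ext A <= 1.
Proof.
by rewrite -inner_contentT; apply: content_ext_ub => //; exact: openT.
Qed.

Lemma content_ext_fin_num A : content_ext A \is a fin_num.
Proof.
rewrite ge0_fin_numE ?content_ext_ge0//.
by rewrite (le_lt_trans (content_ext_le1 A))// ltey.
Qed.

Lemma inner_content_fin_num A : inner_content A \is a fin_num.
Proof.
rewrite ge0_fin_numE ?inner_content_ge0//.
by rewrite (le_lt_trans (inner_content_le1 A))// ltey.
Qed.

Lemma content_ext0 : content_ext set0 = 0.
Proof.
rewrite content_ext_open; last exact: open0.
apply/eqP; rewrite eq_le inner_content_ge0 andbT.
by apply: ge_ereal_sup => x [K [cK]]; rewrite subset0 => -> <-; rewrite lam0.
Qed.

Lemma le_content_ext A B : A `<=` B -> content_ext A <= content_ext B.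
Proof.
move=> AB; apply: le_ereal_inf_tmp => _ [V [oV BV] <-].
by apply: content_ext_ub => //; exact: subset_trans BV.
Qed.

Lemma content_ext_adherent A (e : R) : (0 < e)%R ->
  exists U, [/\ open U, A `<=` U & inner_content U < content_ext A + e%:E].
Proof.
move=> e0; have [_ [U [oU AU] <-] ?] :=
  lb_ereal_inf_adherent e0 (content_ext_fin_num A).
by exists U.
Qed.

(** Induction on [n]: the parts of [K] outside [W] and outside [U n] are disjoint closed sets.
    Removing disjoint open neighbourhoods [V1] and [V2] of them cuts [K] into two closed pieces, one
    inside [W] and one inside [U n]. *)
Lemma lam_bigcup_le (U : (set X)^nat) : (forall n, open (U n)) ->
  forall n K, closed K -> K `<=` \bigcup_(i in `I_n) U i ->
  (lam K)%:E <= \sum_(0 <= i < n) inner_content (U i).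
Proof.
move=> oU; elim=> [|n ih] K cK KU.
  suff -> : K = set0 by rewrite lam0 big_nil.
  by rewrite -subset0 => x /KU[].
set W := \bigcup_(i in `I_n) U i.
have KUW : K `<=` W `|` U n.
  move=> x /KU[i /=]; rewrite ltnS leq_eqVlt => /predU1P[->|ilt] Uix.
    by right.
  by left; exists i.
have oW : open W by apply: bigcup_open.
have [||| V1 [V2 [oV1 oV2 KV1 KV2 V12]]] :=
  @compact_hausdorff_separate X (K `\` W) (K `\` U n) cX hX.
- by apply: closedI => //; exact: open_closedC.
- by apply: closedI => //; exact: open_closedC.
- rewrite -subset0 => x [[Kx Wx] [_ Ux]]; by have [] := KUW _ Kx.
have cD V : open V -> closed (K `\` V).
  by move=> oV; apply: closedI => //; exact: open_closedC.
have -> : K = (K `\` V1) `|` (K `\` V2).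
  by rewrite -setDIr V12 setD0.
rewrite big_nat_recr//=.
apply: (@le_trans _ _ ((lam (K `\` V1))%:E + (lam (K `\` V2))%:E)).
  by rewrite -EFinD lee_fin; apply: lam_sub; exact: cD.
apply: leeD.
  apply: ih; first exact: cD.
  by move=> x [Kx V1x]; apply: contrapT => Wx; apply: V1x; exact: KV1.
apply: inner_content_ub; first exact: cD.
by move=> x [Kx V2x]; apply: contrapT => Wx; apply: V2x; exact: KV2.
Qed.

Lemma inner_content_sigma_subadditive (U : (set X)^nat) :
  (forall n, open (U n)) ->
  inner_content (\bigcup_n U n) <= \sum_(n <oo) inner_content (U n).
Proof.
move=> oU; apply: ge_ereal_sup => _ [K [cK KU] <-].
have := subclosed_compact cK cX (@subsetT _ _).
rewrite compact_cover => /(_ _ setT U)[|//|D _ KD].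
  by move=> i _; exact: oU.
have [n KUn] : exists n, K `<=` \bigcup_(i in `I_n) U i.
  (* The successor is there because [I_n] contains only the indices strictly below [n]. *)
  exists (\max_(i <- finmap.enum_fset D) i).+1 => x /KD[i /= iD Uix].
  by exists i => //=; rewrite ltnS; exact: leq_bigmax_seq.
apply: le_trans (lam_bigcup_le oU cK KUn) _.
by apply: nneseries_lim_ge => *; exact: inner_content_ge0.
Qed.

Lemma content_ext_sigma_subadditive : sigma_subadditive content_ext.
Proof.
move=> A; apply/lee_addgt0Pr => e e0.
apply: le_trans (epsilon_trick xpredT _ (ltW e0)); last first.
  by move=> n; exact: content_ext_ge0.
have en n : (0 < e / (2 ^ n.+1)%:R)%R.
  by rewrite divr_gt0// ltr0n expn_gt0.
have /choice[U PU] := fun n => content_ext_adherent (A n) (en n).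
apply: (@le_trans _ _ (inner_content (\bigcup_n U n))).
  apply: content_ext_ub; first by apply: bigcup_open => n _; case: (PU n).
  by apply: subset_bigcup => n _; case: (PU n).
apply: (@le_trans _ _ (\sum_(n <oo) inner_content (U n))).
  by apply: inner_content_sigma_subadditive => n; case: (PU n).
apply: lee_nneseries => n *; first exact: inner_content_ge0.
by case: (PU n) => _ _ /ltW.
Qed.

HB.instance Definition _ := isOuterMeasure.Build R X content_ext
  content_ext0 content_ext_ge0 le_content_ext content_ext_sigma_subadditive.

(** Exhaust [V] in two stages: a closed [K] inside [V] and [U], then a closed [L] inside the open
    set [V] minus [K], which still contains the part of [V] outside [U]. As [K] and [L] are
    disjoint, [lam_add] bounds the sum of their contents by that of a closed subset of [V]. *)
Lemma inner_content_split U V : open U -> open V ->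
  content_ext (V `&` U) + content_ext (V `&` ~` U) <= inner_content V.
Proof.
move=> oU oV; rewrite content_ext_open; last exact: openI.
rewrite -leeBrDr ?content_ext_fin_num//.
apply: ge_ereal_sup => _ [K [cK KVU] <-].
rewrite leeBrDr ?content_ext_fin_num// addeC -leeBrDr//.
apply: (@le_trans _ _ (inner_content (V `\` K))).
  apply: content_ext_ub.
    by apply: openI => //; exact: closed_openC.
  by apply: setIS; apply: subsetC => x /KVU[].
apply: ge_ereal_sup => _ [L [cL LVK] <-].
rewrite leeBrDr// -EFinD.
apply: (@le_trans _ _ (lam (K `|` L))%:E).
  rewrite lee_fin addrC; apply: lam_add => //.
  by rewrite -subset0 => x [Kx /LVK[]].
apply: inner_content_ub; first exact: closedU.
by move=> x [/KVU[]//|/LVK[]].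
Qed.

Lemma open_caratheodory U : open U -> content_ext.-caratheodory U.
Proof.
move=> oU; apply: le_caratheodory_measurable => A /=.
apply: le_ereal_inf_tmp => _ [V [oV AV] <-].
apply: le_trans (inner_content_split oU oV).
by apply: leeD; apply: le_content_ext; exact: setSI.
Qed.

Lemma borel_caratheodory (A : set (borel X)) :
  measurable A -> content_ext.-cara.-measurable A.
Proof.
apply: smallest_sub => [|U oU]; last exact: open_caratheodory.
exact: sigma_algebra_measurable.
Qed.

Definition content_measure : set (borel X) -> \bar R := content_ext.

Let content_measure_sigma_additive : semi_sigma_additive content_measure.
Proof.
move=> F mF tF mUF; apply: caratheodory_measure_sigma_additive => //.
- by move=> n; exact: borel_caratheodory.
- exact: borel_caratheodory.
Qed.

HB.instance Definition _ := isMeasure.Build _ _ _ content_measure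
  content_ext0 content_ext_ge0 content_measure_sigma_additive.

Let content_measureT : content_measure setT = 1.
Proof.
by rewrite /content_measure content_ext_open ?inner_contentT//; exact: openT.
Qed.

HB.instance Definition _ := Measure_isProbability.Build _ _ _ content_measure
  content_measureT.

(** Outer regularity is built into [content_ext]. Inner regularity follows by complements: if [U] is
    an open set around the complement of [A] with nearly the same mass, then the complement of [U]
    is a compact subset of [A] with nearly the mass of [A]. *)
Lemma content_measure_regular :
  regular_measure (content_measure : probability (borel X) R).
Proof.
have mo (U : set X) : open U -> measurable (U : set (borel X)).
  by move=> oU; exact: sub_sigma_algebra.
move=> A mA; split.
  rewrite /= /content_measure /content_ext; congr ereal_inf.
  by apply/seteqP; split => [_ [U [oU AU] <-]|_ [U [oU AU] <-]]; exists U => //;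
    rewrite -/(content_ext U) content_ext_open.
apply/eqP; rewrite eq_le; apply/andP; split; last first.
  by apply: ge_ereal_sup => _ [K [_ KA] <-]; exact: le_content_ext.
apply/lee_addgt0Pr => e e0.
have [U [oU AU Ue]] := content_ext_adherent (~` A) e0.
have cU : content_ext (~` U) = 1 - inner_content U.
  rewrite -(content_ext_open oU).
  by have := @probability_setC _ _ _ content_measure U (mo _ oU).
have cA : content_ext (~` A) = 1 - content_ext A.
  by have := @probability_setC _ _ _ content_measure A mA.
rewrite -leeBlDr//; apply: le_ereal_sup_tmp => /=.
exists (content_ext (~` U)).
  exists (~` U) => //; split; last exact: subsetCl.
  by apply: subclosed_compact cX _ => //; exact: open_closedC.
move: Ue; rewrite cU cA /content_measure.
rewrite -(fineK (content_ext_fin_num A)) -(fineK (inner_content_fin_num U)).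
by rewrite -!EFinD lte_fin lee_fin; lra.
Qed.

End content_measure.

(** * Left translates and the algebra of sets with open stabilizer *)

Definition ltrans (G : groupType) (h : G) (A : set G) : set G :=
  [set g | A (h^-1 * g)%g].

Lemma ltrans1 (G : groupType) (A : set G) : ltrans 1%g A = A.
Proof. by apply/seteqP; split => g; rewrite /ltrans/= invg1 mul1g. Qed.

Lemma ltransM (G : groupType) (h k : G) (A : set G) :
  ltrans (h * k)%g A = ltrans h (ltrans k A).
Proof. by apply/seteqP; split => g; rewrite /ltrans/= invgM mulgA. Qed.

Section open_stabilizers.
Variable G : topologicalGroupType.
Implicit Types (g h k : G) (A B : set G).

(** A subgroup is open as soon as it is a neighbourhood of the identity. *)
Definition open_stab A := nbhs (1%g : G) [set h | ltrans h A = A].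

Lemma mulgl_continuous g : continuous (fun h => g * h)%g.
Proof.
move=> h; apply: (@continuous2_cvg _ _ _ _ _ _ (fun=> g) id
  (fun x y : G => x * y)%g g h); last 2 first.
- exact: cvg_cst.
- exact: cvg_id.
- exact: (@mulg_continuous G (g, h)).
Qed.

Lemma mulgr_continuous g : continuous (fun h => h * g)%g.
Proof.
move=> h; apply: (@continuous2_cvg _ _ _ _ _ _ id (fun=> g)
  (fun x y : G => x * y)%g h g); last 2 first.
- exact: cvg_id.
- exact: cvg_cst.
- exact: (@mulg_continuous G (h, g)).
Qed.

(** For [k] near [h], the element [h^-1 * k] is near the identity and so stabilizes [A]. This local
    constancy gives both the countability of the orbit of [A] and the joint continuity of [flow]. *)
Lemma near_ltrans A h : open_stab A ->
  \forall k \near h, ltrans k A = ltrans h A.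
Proof.
move=> oA.
have {}oA : nbhs (h^-1 * h)%g [set k | ltrans k A = A] by rewrite mulVg.
have : nbhs h [set k | ltrans (h^-1 * k)%g A = A].
  exact: (@mulgl_continuous h^-1%g h _ oA).
apply: filterS => k /= kA.
by rewrite -[in RHS]kA -ltransM mulVKg.
Qed.

Lemma open_stab_ltrans A h : open_stab A -> open_stab (ltrans h A).
Proof.
move=> sA.
have oA : nbhs (1 * h)%g [set k | ltrans k A = ltrans h A].
  by rewrite mul1g; exact: near_ltrans.
have : nbhs (1%g : G) [set k | ltrans (k * h)%g A = ltrans h A].
  exact: (@mulgr_continuous h 1%g _ oA).
by apply: filterS => k /=; rewrite ltransM.
Qed.

Lemma open_stabT : open_stab setT.
Proof.
by rewrite /open_stab; apply: filterS filterT => h _; apply/seteqP; split.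
Qed.

Lemma open_stabC A : open_stab A -> open_stab (~` A).
Proof.
rewrite /open_stab; apply: filterS => h /= hA.
by rewrite -[in RHS]hA; apply/seteqP; split.
Qed.

Lemma open_stabU A B : open_stab A -> open_stab B -> open_stab (A `|` B).
Proof.
rewrite /open_stab => oA oB; near=> h; have hA : ltrans h A = A by near: h.
have hB : ltrans h B = B by near: h.
by rewrite /= -[in RHS]hA -[in RHS]hB; apply/seteqP; split.
Unshelve. all: by end_near. Qed.

Lemma open_stabI A B : open_stab A -> open_stab B -> open_stab (A `&` B).
Proof.
move=> oA oB; rewrite -[_ `&` _]setCK setCI.
by apply/open_stabC/open_stabU; exact: open_stabC.
Qed.

End open_stabilizers.

(** * From an invariant mean to an invariant measure *)

Section means.
Context (R : realType) (G : topologicalGroupType).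

(** [m] is total for convenience: additivity and invariance are only asked for on sets with open
    stabilizer. *)
Definition invariant_mean (m : set G -> R) : Prop :=
  [/\ m setT = 1, forall A, 0 <= m A,
      forall A B, open_stab A -> open_stab B -> A `&` B = set0 ->
        m (A `|` B) = m A + m B &
      forall h A, open_stab A -> m (ltrans h A) = m A].

Variable m : set G -> R.
Hypothesis mP : invariant_mean m.

Lemma mean_ge0 A : 0 <= m A. Proof. by case: mP. Qed.

Lemma mean_le A B : open_stab A -> open_stab B -> A `<=` B -> m A <= m B.
Proof.
move=> oA oB AB; have -> : B = A `|` (B `\` A) by rewrite setDUK.
case: mP => _ m0 mU _; rewrite mU ?lerDl//.
- by apply: open_stabI => //; exact: open_stabC.
- by rewrite setDIK.
Qed.

Lemma mean0 : m set0 = 0.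
Proof.
have o0 : open_stab (@set0 G) by rewrite -setCT; exact/open_stabC/open_stabT.
case: mP => _ _ /(_ _ _ o0 o0); rewrite setU0 setI0 => /(_ erefl) + _.
by lra.
Qed.

Lemma mean_leU A B : open_stab A -> open_stab B -> m (A `|` B) <= m A + m B.
Proof.
move=> oA oB; have oD : open_stab (B `\` A).
  by apply: open_stabI => //; exact: open_stabC.
have -> : A `|` B = A `|` (B `\` A) by rewrite setUDr setDv setD0.
case: (mP) => _ _ mU _; rewrite mU//; last by rewrite setDIK.
by rewrite lerD2l; apply: mean_le => //; exact: subDsetl.
Qed.

Variables (X : ptopologicalType) (act : G -> X -> X).
Hypotheses (nonarchG : non_archimedean G) (cX : compact [set: X])
  (hX : hausdorff_space X) (actP : continuous_action act).

Let act1 x : act 1%g x = x. Proof. by case: actP. Qed.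
Let actM g h x : act (g * h)%g x = act g (act h x). Proof. by case: actP. Qed.
Let actc : continuous (fun p : G * X => act p.1 p.2).
Proof. by case: actP. Qed.

Let actK g : cancel (act g) (act g^-1%g).
Proof. by move=> x; rewrite -actM mulVg act1. Qed.

Let actVK g : cancel (act g^-1%g) (act g).
Proof. by move=> x; rewrite -actM mulgV act1. Qed.

Let act_continuous g : continuous (act g).
Proof.
move=> x; apply: (@continuous2_cvg _ _ _ _ _ _ (fun=> g) id act g x);
  last 2 first.
- exact: cvg_cst.
- exact: cvg_id.
- exact: (@actc (g, x)).
Qed.

Let act_image g A : act g @` A = act g^-1%g @^-1` A.
Proof.
apply/seteqP; split => [_ [x Ax <-]|x Ax]; first by rewrite /= actK.
by exists (act g^-1%g x) => //; rewrite actVK.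
Qed.

Let act_image_open g U : open U -> open (act g @` U).
Proof. by rewrite act_image; move: U; exact/continuousP. Qed.

Let act_image_closed g U : closed U -> closed (act g @` U).
Proof. by rewrite act_image; move: U; exact/continuous_closedP. Qed.

Let x0 : X := point.

(** The set of [g] that send [x0] into [U] need not have an open stabilizer itself, hence the
    approximation from above by sets [A] that do. *)
Definition orbit_cover (K : set X) (A : set G) :=
  open_stab A /\
  exists U, [/\ open U, K `<=` U & forall g, U (act g x0) -> A g].

Definition orbit_content (K : set X) : R :=
  inf [set m A | A in orbit_cover K].

Let orbit_coverT K : orbit_cover K setT.
Proof. by split; [exact: open_stabT|exists setT; split => //; exact: openT]. Qed.

Let content_has_inf K : has_inf [set m A | A in orbit_cover K].
Proof.
split; first by exists (m setT); exists setT.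
by exists 0 => _ [A _ <-]; exact: mean_ge0.
Qed.

Let content_ub K A : orbit_cover K A -> orbit_content K <= m A.
Proof.
by move=> KA; apply: inf_lbound; [case: (content_has_inf K)|exists A].
Qed.

Let content_lb K (r : R) : (forall A, orbit_cover K A -> r <= m A) ->
  r <= orbit_content K.
Proof.
move=> rK; apply: lb_le_inf; first by case: (content_has_inf K).
by move=> _ [A KA <-]; exact: rK.
Qed.

Lemma orbit_content0 : orbit_content set0 = 0.
Proof.
apply/eqP; rewrite eq_le; apply/andP; split; last first.
  by apply: content_lb => A _; exact: mean_ge0.
rewrite -mean0; apply: content_ub; split.
  by rewrite -setCT; exact/open_stabC/open_stabT.
by exists set0; split => //; exact: open0.
Qed.

Lemma orbit_contentT : orbit_content setT = 1.
Proof.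
have m1 : m setT = 1 by case: mP.
apply/eqP; rewrite eq_le; apply/andP; split; rewrite -m1.
  exact: content_ub.
apply: content_lb => A [oA [U [oU TU UA]]].
by rewrite (_ : A = setT)//; apply/seteqP; split => // g _; exact/UA/TU.
Qed.

Lemma le_orbit_content K L : K `<=` L -> orbit_content K <= orbit_content L.
Proof.
move=> KL; apply: content_lb => A [oA [U [oU LU UA]]]; apply: content_ub.
by split => //; exists U; split => //; exact: subset_trans LU.
Qed.

Lemma orbit_contentU K L :
  orbit_content (K `|` L) <= orbit_content K + orbit_content L.
Proof.
rewrite -lerBlDl; apply: content_lb => B [oB [V [oV LV VB]]].
rewrite lerBlDl -lerBlDr; apply: content_lb => A [oA [U [oU KU UA]]].
rewrite lerBlDr (le_trans _ (mean_leU oA oB))//.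
apply: content_ub; split; first exact: open_stabU.
exists (U `|` V); split; [exact: openU|exact: setUSS|].
by move=> g [/UA|/VB]; [left|right].
Qed.

(* [A] is the saturation of [{g | g x0 \in U}] under an open subgroup of [G]
   that moves the neighbourhood [U] of [K] within [V]. *)
Lemma orbit_cover_fatten K V : closed K -> open V -> K `<=` V ->
  exists2 A, orbit_cover K A & forall g, A g -> V (act g x0).
Proof.
move=> cK oV KV.
have [U [oU KU clUV]] := compact_hausdorff_shrink cX hX cK oV KV.
have /compact_near_coveringP cU : compact (closure U).
  exact: subclosed_compact (@closed_closure _ _) cX (@subsetT _ _).
(* Tube argument: joint continuity at each point [(1, x)] and compactness of [closure U] give one
   neighbourhood of the identity that works for all [x]. *)
have NV : nbhs (1%g : G) [set h | closure U `<=` [set x | V (act h x)]].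
  apply: cU => x /clUV Vx.
  have V1 : nbhs (act (1%g : G, x).1 (1%g : G, x).2) V.
    by rewrite /= act1; exact: open_nbhs_nbhs.
  have [[/= N W] [/= N1 Wx] NWV] := @actc (1%g, x) _ V1.
  exists (W, N) => // -[y h] [/= Wy Nh].
  exact: (NWV (h, y)).
have [_ /(_ _ NV)[H [oH H_group HN]]] := nonarchG.
have H1 : H 1%g by case: H_group => /set_mem.
have HV h : H h -> H h^-1%g.
  by move=> /mem_set hH; have /group_closedV/(_ _ hH)/set_mem := H_group.
have HM h k : H h -> H k -> H (h * k)%g.
  move=> /mem_set hH /mem_set kH.
  by have /group_closedM/(_ _ _ hH kH)/set_mem := H_group.
(* For such [g], the point [act g x0] is the image under [h^-1], again in [H], of a point of [U], so
   it lies in [V]. *)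
exists [set g | exists2 h, H h & U (act (h * g)%g x0)]; last first.
  move=> g [h /HV /HN /(_ (act (h * g)%g x0)) hV Uhg].
  by move: hV; rewrite /= -actM mulKg; apply; exact: subset_closure.
split; last first.
  by exists U; split => // g Ug; exists 1%g => //; rewrite mul1g.
rewrite /open_stab; apply: (@filterS _ (nbhs (1%g : G)) _ H); last first.
  exact: open_nbhs_nbhs.
move=> k Hk; apply/seteqP; split => g [h Hh Ug].
  by exists (h * k^-1)%g; [exact/HM/HV|rewrite -mulgA].
by exists (h * k)%g; [exact: HM|rewrite -mulgA mulVKg].
Qed.

(** Fattening inside disjoint open sets yields disjoint [A] and [B] covering [K] and [L]. Any cover
    [C] of the union then contains the disjoint sets [C] cut with [A] and [C] cut with [B], which
    cover [K] and [L] respectively. *)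
Lemma orbit_contentD K L : closed K -> closed L -> K `&` L = set0 ->
  orbit_content K + orbit_content L <= orbit_content (K `|` L).
Proof.
move=> cK cL KL.
have [V [W [oV oW KV LW VW]]] := compact_hausdorff_separate cX hX cK cL KL.
have [A [oA [V' [oV' KV' VA]]] AV] := orbit_cover_fatten cK oV KV.
have [B [oB [W' [oW' LW' WB]]] BW] := orbit_cover_fatten cL oW LW.
apply: content_lb => C [oC [U [oU KLU UC]]].
have oCA := open_stabI oC oA; have oCB := open_stabI oC oB.
apply: (@le_trans _ _ (m (C `&` A) + m (C `&` B))).
  apply: lerD; apply: content_ub; split => //.
    exists (U `&` V'); split; first exact: openI.
      by move=> x Kx; split; [apply: KLU; left|exact: KV'].
    by move=> g [/UC ? /VA ?].
  exists (U `&` W'); split; first exact: openI.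
    by move=> x Lx; split; [apply: KLU; right|exact: LW'].
  by move=> g [/UC ? /WB ?].
have [_ _ mU _] := mP; rewrite -mU//; last first.
  rewrite -subset0 => g [[_ /AV Vg] [_ /BW Wg]].
  have : (V `&` W) (act g x0) by split.
  by rewrite VW.
apply: mean_le => //; first exact: open_stabU.
by move=> g [[]|[]].
Qed.

(** Translating a cover of [L] by [h] gives a cover of its image with the same mean. This proves one
    inequality for every [h]; the other is the same inequality for the inverse. *)
Lemma orbit_content_act g K : orbit_content (act g @` K) = orbit_content K.
Proof.
have le h L : orbit_content (act h @` L) <= orbit_content L.
  apply: content_lb => A [oA [U [oU LU UA]]].
  have [_ _ _ /(_ h A oA) <-] := mP.
  apply: content_ub; split; first exact: open_stab_ltrans.
  exists (act h @` U); split; [exact: act_image_open|exact: image_subset|].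
  by rewrite act_image => k /=; rewrite -actM => /UA.
apply/eqP; rewrite eq_le le/=.
have := le g^-1%g (act g @` K); rewrite image_comp.
by rewrite eq_image_id// => x _ /=; rewrite actK.
Qed.

Let orbit_content_mono K L : closed K -> closed L -> K `<=` L ->
  orbit_content K <= orbit_content L.
Proof. by move=> _ _; exact: le_orbit_content. Qed.

Let orbit_content_sub K L : closed K -> closed L ->
  orbit_content (K `|` L) <= orbit_content K + orbit_content L.
Proof. by move=> _ _; exact: orbit_contentU. Qed.

Lemma inner_content_act g U :
  inner_content orbit_content (act g @` U) = inner_content orbit_content U.
Proof.
have le h V : (inner_content orbit_content V <=
    inner_content orbit_content (act h @` V))%E.
  apply: ge_ereal_sup => _ [K [cK KV] <-]; rewrite -(orbit_content_act h).
  by apply: inner_content_ub; [exact: act_image_closed|exact: image_subset].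
apply/eqP; rewrite eq_le le andbT.
apply: le_trans (le g^-1%g _) _; rewrite image_comp.
by rewrite eq_image_id// => x _ /=; rewrite actK.
Qed.

Lemma content_ext_act g A :
  content_ext orbit_content (act g @` A) = content_ext orbit_content A.
Proof.
have le h B : (content_ext orbit_content (act h @` B) <=
    content_ext orbit_content B)%E.
  apply: le_ereal_inf_tmp => _ [U [oU BU] <-]; rewrite -(inner_content_act h).
  by apply: content_ext_ub; [exact: act_image_open|exact: image_subset].
apply/eqP; rewrite eq_le le/=.
apply: le_trans (le g^-1%g _); rewrite image_comp.
by rewrite eq_image_id// => x _ /=; rewrite actK.
Qed.

Lemma invariant_mean_measure : exists mu : probability (borel X) R,
  regular_measure mu /\ invariant_measure act mu.
Proof.
have reg := content_measure_regular cX hX orbit_content0 orbit_contentT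
  orbit_content_mono orbit_content_sub orbit_contentD.
eexists; split; first exact: reg.
by move=> g A mA; exact: content_ext_act.
Qed.

End means.

(** * Coordinatewise continuity and compactness of subspaces *)

Lemma cantor_near (z : cantor_space) n : \forall w \near z, w n = z n.
Proof.
exists (proj n @^-1` [set z n]); split => //.
suff : @open cantor_space (proj n @^-1` [set z n]) by [].
by apply: open_comp; [move=> + _; exact: proj_continuous|exact: discrete_open].
Qed.

Lemma cantor_continuous (S : topologicalType) (f : S -> cantor_space) :
  (forall s n, \forall t \near s, f t n = f s n) -> continuous f.
Proof.
move=> fn s; apply/cvg_sup => n U [V] [[W] oW <-] Wfs WU.
apply: (filterS WU); rewrite nbhs_simpl /=.
by apply: filterS (fn s n) => t /= ->.
Qed.

Lemma map_snd_continuous (S T T' : topologicalType) (f : T -> T') :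
  continuous f -> continuous (fun p : S * T => (p.1, f p.2)).
Proof.
move=> fc [s t] U [[V W] /= [Vs Wt] VWU].
exists (V, f @^-1` W) => /=; first by split => //; exact: fc.
by move=> [s' t'] [/= Vs' Wt']; exact: VWU.
Qed.

Lemma compact_set_type (T : topologicalType) (A : set T) :
  compact A -> compact [set: A].
Proof.
move=> cA F FF _.
have FA : F (set_val @^-1` A) by apply: filterS filterT => a _; exact: set_valP.
have [x [Ax clx]] := cA _ (fmap_proper_filter set_val FF) FA.
exists (exist _ x (mem_set Ax)); split => // P Q FP [_ [[W oW <-] Wx WQ]].
have FP' : F (set_val @^-1` (set_val @` P)).
  by apply: filterS FP => a Pa; exists a.
have [_ [[a Pa <-] Wa]] := clx _ _ FP' (open_nbhs_nbhs (conj oW Wx)).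
by exists a; split => //; exact: WQ.
Qed.

(** [I] need not be closed under unions, so additivity is conditional on the union lying in [I]. The
    bounds hold for all sets, which places every ultralimit in [[0, 1]]. *)
Definition invariant_mean_on (R : realType) (G : groupType)
    (I : set (set G)) (m : set G -> R) : Prop :=
  [/\ m setT = 1, forall A, 0 <= m A <= 1,
      forall A B, I A -> I B -> I (A `|` B) -> A `&` B = set0 ->
        m (A `|` B) = m A + m B &
      forall h A, I A -> m (ltrans h A) = m A].

(** * The Cantor space of two-valued models of a countable family *)

Section model_space.
Context (G : topologicalGroupType) (I : set (set G)) (e : nat -> set G).
Hypotheses (eI : forall n, I (e n)) (eS : forall A, I A -> exists n, e n = A).
Hypothesis IS : I `<=` @open_stab G.
Hypothesis IT : I setT.
Hypothesis It : forall h A, I A -> I (ltrans h A).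

(** The enumeration [e] may repeat sets, so one index is chosen for each; the first clause of
    [models] makes the other even coordinates agree with it. Sets not listed get the junk index
    0. *)
Let idx (A : set G) : nat := xget 0%N [set n | e n = A].

Let idxK A : I A -> e (idx A) = A.
Proof. by move=> /eS eA; exact: (xgetPex 0%N eA). Qed.

Definition value (z : cantor_space) (A : set G) : bool := z (idx A).*2.

(* The even coordinates list the values on [e 0], [e 1], etc.; the odd
   coordinates are unconstrained, which makes this set perfect. *)
Definition models : set cantor_space := [set z |
  [/\ forall n, z n.*2 = value z (e n),
      value z setT &
      forall A B, I A -> I B -> I (A `|` B) -> A `&` B = set0 ->
        value z (A `|` B) = value z A || value z B /\
        ~~ (value z A && value z B)]].

(** Each instance of a defining condition involves at most three coordinates, and a point of the
    closure agrees with some model on any three. *)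
Lemma models_closed : closed models.
Proof.
move=> z clz.
have ag i j k : exists2 w, models w & [/\ w i = z i, w j = z j & w k = z k].
  have [w [mw [? [? ?]]]] := clz _ (filterI (cantor_near z i)
    (filterI (cantor_near z j) (cantor_near z k))).
  by exists w.
split.
- move=> n; have [w [wn _ _] [<- + _]] := ag n.*2 (idx (e n)).*2 0%N.
  by rewrite /value => <-; exact: wn.
- by rewrite /value; have [w [_ wT _] [<-]] := ag (idx setT).*2 0%N 0%N.
move=> A B IA IB IAB AB; rewrite /value.
have [w [_ _ wU] [<- <- <-]] :=
  ag (idx A).*2 (idx B).*2 (idx (A `|` B)).*2.
exact: wU.
Qed.

(** The point mass at the identity, showing that models exist. *)
Definition base_model : cantor_space :=
  fun n => ~~ odd n && `[< e n./2 1%g >].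

Lemma base_model_value A : I A -> value base_model A = `[< A 1%g >].
Proof.
by move=> IA; rewrite /value /base_model odd_double doubleK idxK.
Qed.

Definition flow (h : G) (z : cantor_space) : cantor_space :=
  fun n => if odd n then z n else value z (ltrans h^-1%g (e n./2)).

Lemma flow_value h z A : I A -> value (flow h z) A = value z (ltrans h^-1%g A).
Proof.
by move=> IA; rewrite {1}/value /flow odd_double doubleK idxK.
Qed.

Lemma flow_models h z : models z -> models (flow h z).
Proof.
move=> [zn zT zU]; split.
- by move=> n; rewrite flow_value// /flow odd_double doubleK.
- by rewrite flow_value.
move=> A B IA IB IAB AB; rewrite !flow_value//.
have := zU _ _ (It h^-1%g IA) (It h^-1%g IB) (It h^-1%g IAB); apply.
rewrite -subset0 => g [Ag Bg].
by have : (A `&` B) (h^-1^-1 * g)%g by []; rewrite AB.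
Qed.

Lemma flow1 z : models z -> flow 1%g z = z.
Proof.
move=> [zn _ _]; apply/funext => n; rewrite /flow invg1 ltrans1.
by case: ifPn => // nE; rewrite -zn even_halfK.
Qed.

Lemma flowM g h z : flow (g * h)%g z = flow g (flow h z).
Proof.
apply/funext => n; rewrite /flow; case: ifPn => // _.
by rewrite -/(flow h z) flow_value ?invgM ?ltransM//; exact: It.
Qed.

(** An even coordinate depends on [h] only through a translate of [e n./2], which is locally
    constant in [h], and then on a single coordinate of [z]. *)
Lemma flow_near h z n : \forall p \near (h, z), flow p.1 p.2 n = flow h z n.
Proof.
rewrite /flow; case: ifPn => _.
  exists (setT, [set w : cantor_space | w n = z n]) => /=.
    by split; [exact: filterT|exact: cantor_near].
  by move=> [k w] [].
set A := e n./2.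
have hA : \forall k \near h, ltrans k^-1%g A = ltrans h^-1%g A.
  exact: (@invg_continuous G h _ (near_ltrans h^-1%g (IS (eI _)))).
exists ([set k | ltrans k^-1%g A = ltrans h^-1%g A],
  [set w | value w (ltrans h^-1%g A) = value z (ltrans h^-1%g A)]) => /=.
  by split => //; exact: cantor_near.
by move=> [k w] [/= -> ].
Qed.

Lemma base_model_models : models base_model.
Proof.
split.
- by move=> n; rewrite base_model_value// /base_model odd_double doubleK.
- by rewrite base_model_value//; exact/asboolP.
move=> A B IA IB IAB AB; rewrite !base_model_value//.
split; first by rewrite -asbool_or.
rewrite -asbool_and; apply/asboolPn => -[A1 B1].
by have : (A `&` B) 1%g by []; rewrite AB.
Qed.

Definition model_space : Type := set_type models.

HB.instance Definition _ := Uniform.copy model_space (set_type models).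
HB.instance Definition _ := isPointed.Build model_space
  (exist _ base_model (mem_set base_model_models)).
HB.instance Definition _ (R : realType) : @PseudoMetric R model_space :=
  PseudoMetric.copy model_space
    (initial_topology (set_val : set_type models -> cantor_space)).

Definition model_val (z : model_space) : cantor_space := set_val z.

Lemma model_valP z : models (model_val z). Proof. exact: set_valP. Qed.

Lemma model_val_inj : injective model_val. Proof. exact: val_inj. Qed.

Lemma model_val_continuous : continuous model_val.
Proof. exact: initial_continuous. Qed.

Definition model_flow h (z : model_space) : model_space :=
  exist _ (flow h (model_val z)) (mem_set (flow_models h (model_valP z))).

Lemma model_val_flow h z : model_val (model_flow h z) = flow h (model_val z).
Proof. by []. Qed.

Lemma model_val_clopen n b : clopen [set z | model_val z n = b].
Proof.
have -> : [set z | model_val z n = b] =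
  (fun z => model_val z n) @^-1` [set b] by [].
apply: preimage_clopen.
  by split; [exact: discrete_open|exact: discrete_closed].
move=> z U Uz; rewrite nbhs_simpl.
have : nbhs z [set w | model_val w n = model_val z n].
  exact: (@model_val_continuous z _ (cantor_near (model_val z) n)).
by apply: filterS => w /= ->; exact: nbhs_singleton.
Qed.

Lemma model_space_zero_dimensional : zero_dimensional model_space.
Proof.
move=> x y /eqP xy.
have [n xyn] : exists n, model_val x n <> model_val y n.
  by apply/existsNP => xyn; apply/xy/model_val_inj/funext.
exists [set z | model_val z n = model_val x n].
by split => //=; [exact: model_val_clopen|exact: nesym].
Qed.

Lemma model_space_hausdorff : hausdorff_space model_space.
Proof.
rewrite open_hausdorff => x y /model_space_zero_dimensional[U [[oU cU] Ux Uy]].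
exists (U, ~` U); split => /=; rewrite ?inE//.
- exact: closed_openC.
- by rewrite setICr.
Qed.

(** Flipping the unconstrained coordinate [2n+1] of [z] gives models different from [z] that
    converge to [z] as [n] grows. *)
Lemma model_space_perfect : perfect_set [set: model_space].
Proof.
apply/perfectTP => z [W oW Wz].
pose w n : cantor_space :=
  fun k => if k == n.*2.+1 then ~~ model_val z k else model_val z k.
have w_models n : models (w n).
  have wE k : w n k.*2 = model_val z k.*2.
    rewrite /w; case: eqP => // kn.
    by have := odd_double k; rewrite kn /= odd_double.
  have wV B : value (w n) B = value (model_val z) B by exact: wE.
  have [zn zT zU] := model_valP z; split.
  - by move=> k; rewrite wE wV zn.
  - by rewrite wV.
  - by move=> B C; rewrite !wV; exact: zU.
have wz : w @ \oo --> model_val z.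
  apply/cvg_sup => N U [V] [[Q] oQ <-] QzN QU.
  apply: (filterS QU); rewrite nbhs_simpl; exists N => // n /= Nn.
  rewrite /w; case: eqP => // E.
  by move: Nn; rewrite E -addnn leqNgt ltnS leq_addr.
have : nbhs (model_val z) W.
  apply: open_nbhs_nbhs; split => //.
  by have : (set_val @^-1` W) z by rewrite Wz.
move=> /wz[N _ /(_ _ (leqnn _)) WwN].
pose wN : model_space := exist _ (w N) (mem_set (w_models N)).
have : (set_val @^-1` W) wN by [].
rewrite Wz => /(congr1 (fun y => model_val y N.*2.+1)).
by rewrite (erefl : model_val wN = w N) /w eqxx; case: (model_val z _).
Qed.

Lemma model_space_cantor_like : cantor_like model_space.
Proof.
split; [exact: model_space_perfect| |exact: model_space_hausdorff|
  exact: model_space_zero_dimensional].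
apply: compact_set_type.
exact: subclosed_compact models_closed cantor_space_compact (@subsetT _ _).
Qed.

Lemma model_space_homeomorphic (R : realType) :
  homeomorphic cantor_space model_space.
Proof.
have [f [fc fcl]] := @homeomorphism_cantor_like R _ model_space_cantor_like.
have [f' fK f'K] : bijective f by rewrite -setTT_bijective; exact: bij.
(* [fcl] says that [f] is a closed map; the image of [A] under [f] is its preimage under [f']. *)
exists f, f'; split => //; apply/continuous_closedP => A /fcl.
congr closed; apply/seteqP; split => [_ [x Ax <-]|y Ay].
  by rewrite /= fK.
by exists (f' y).
Qed.

Lemma model_flow_continuous :
  continuous (fun p : G * model_space => model_flow p.1 p.2).
Proof.
apply: continuous_comp_initial; apply: cantor_continuous => -[h z] n /=.
exact: (@map_snd_continuous G _ _ _ model_val_continuous (h, z) _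
  (flow_near h (model_val z) n)).
Qed.

(** The flow is transported to the Cantor set along the homeomorphism, and the mass of [A] is the
    measure of the models that give [A] the value 1. *)
Lemma models_mean (R : realType) :
  (forall act : G -> cantor_space -> cantor_space, continuous_action act ->
     exists mu : probability (borel cantor_space) R, invariant_measure act mu) ->
  exists m : set G -> R, invariant_mean_on I m.
Proof.
move=> cantorP; have [f [f' [fc f'c fK f'K]]] := model_space_homeomorphic R.
pose act h w := f' (model_flow h (f w)).
have actP : continuous_action act.
  split.
  - move=> w; rewrite /act -[RHS]fK; congr f'; apply: model_val_inj.
    by rewrite model_val_flow flow1//; exact: (model_valP (f w)).
  - move=> g h w; rewrite /act f'K; congr f'; apply: model_val_inj.
    by rewrite !model_val_flow flowM.
  have actc : continuous (f' \o
      ((fun q : G * model_space => model_flow q.1 q.2) \o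
      (fun p : G * cantor_space => (p.1, f p.2)))).
    move=> p; apply: continuous_comp; last exact: f'c.
    apply: continuous_comp; first exact: map_snd_continuous.
    exact: model_flow_continuous.
  exact: actc.
have [mu muP] := cantorP act actP.
pose E A : set (borel cantor_space) := [set w | value (model_val (f w)) A].
have mE A : measurable (E A).
  apply: sub_sigma_algebra.
  have [oE _] := model_val_clopen (idx A).*2 true.
  have -> : E A = f @^-1` [set z | model_val z (idx A).*2 = true] by [].
  by apply: open_comp => // w _; exact: fc.
have muE A : (fine (mu (E A)))%:E = mu (E A).
  by rewrite fineK// fin_num_measure.
exists (fun A => fine (mu (E A))); split.
- rewrite (_ : E setT = setT) ?probability_setT//.
  by apply/seteqP; split => // w _; have [_ + _] := model_valP (f w).
- move=> A; rewrite fine_ge0//= -lee_fin muE.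
  by rewrite probability_le1.
- move=> A B IA IB IAB AB; apply: EFin_inj; rewrite EFinD !muE.
  rewrite -measureU//.
    congr (mu _); apply/seteqP; split => w;
      have [_ _ /(_ A B IA IB IAB AB)[wU _]] := model_valP (f w).
      by rewrite /E /= wU => /orP[]; [left|right].
    by rewrite /E /= wU => -[] ->; rewrite ?orbT.
  rewrite -subset0 => w [wA wB].
  have [_ _ /(_ A B IA IB IAB AB)[_ /negP]] := model_valP (f w).
  by apply; apply/andP.
(* Invariance is used at [h^-1], since [invariant_measure] takes images under the inverse:
   [E (ltrans h A)] is the image of [E A] under [act h]. *)
move=> h A IA; rewrite -(muP h^-1%g (E A) (mE A)) invgK.
congr (fine (mu _)); apply/seteqP; split.
  move=> w Ew; exists (act h^-1%g w); last first.
    by case: actP => a1 aM _; rewrite -aM mulgV a1.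
  by rewrite /E /= /act f'K model_val_flow flow_value// invgK.
move=> _ [w Ew <-]; rewrite /E /= /act f'K model_val_flow flow_value;
  last exact: It.
by rewrite -ltransM mulVg ltrans1.
Qed.

End model_space.

(** * Gluing the means of countable families by an ultralimit *)

Lemma ultra_fmap (T U : Type) (f : T -> U) (F : set_system T) :
  UltraFilter F -> UltraFilter (fmap f F).
Proof.
move=> FU; split; first exact: fmap_proper_filter.
move=> H HH FH; apply/seteqP; split => // A HA.
have [//|FA] := in_ultra_setVsetC (f @^-1` A) FU.
have /filter_ex[x []//] : H (A `&` ~` A) by apply: filterI => //; exact: FH.
Qed.

Lemma countable_setU (T : Type) (A B : set T) :
  countable A -> countable B -> countable (A `|` B).
Proof.
move=> cA cB; rewrite -bigcup2E; apply: bigcup_countable => // -[|[|n]] _ //=.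
Qed.

Section mean_of_cantor.
Context (R : realType) (G : topologicalGroupType).
Hypothesis sepG : separable_space G.
Hypothesis cantorP : forall act : G -> cantor_space -> cantor_space,
  continuous_action act ->
  exists mu : probability (borel cantor_space) R, invariant_measure act mu.

(* Directed under inclusion: [cantor_invariant_mean] takes an ultralimit along
   it. *)
Definition mean_family : set (set (set G)) := [set I |
  [/\ countable I, I `<=` @open_stab G, I setT &
      forall h A, I A -> I (ltrans h A)]].

Lemma mean_family_mean I : mean_family I ->
  exists m : set G -> R, invariant_mean_on I m.
Proof.
move=> [cI IS IT It].
have [|[e]] := pfcard_geP cI; first by move=> I0; move: IT; rewrite I0.
apply: (@models_mean _ I e) => //.
- by move=> n; exact: funS.
- by move=> A IA; have [n _ <-] := @surj _ _ _ _ e _ IA; exists n.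
Qed.

Lemma mean_familyU I J : mean_family I -> mean_family J ->
  mean_family (I `|` J).
Proof.
move=> [cI IS IT It] [cJ JS JT Jt]; split.
- exact: countable_setU.
- by move=> A [/IS|/JS].
- by left.
- by move=> h A [/(It h)|/(Jt h)]; [left|right].
Qed.

(** Take all translates of [A], together with [setT]. Translation is locally constant on [A], so
    translates by a countable dense set already give all of them. *)
Lemma mean_family_ex A : open_stab A -> exists2 I, mean_family I & I A.
Proof.
move=> oA; have [D cD dD] := sepG.
exists ((ltrans (G := G))^~ A @` setT `|` [set setT]); last first.
  by left; exists 1%g => //; rewrite ltrans1.
split; last 3 first.
- by move=> _ [[h _ <-]|->]; [exact: open_stab_ltrans|exact: open_stabT].
- by right.
- move=> k _ [[h _ <-]|->]; last by right; apply/seteqP; split.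
  by left; exists (k * h)%g => //; rewrite ltransM.
apply: countable_setU => //.
apply: sub_countable
  (card_le_trans (card_image_le ((ltrans (G := G))^~ A) D) cD).
apply: subset_card_le => _ [h _ <-].
have [U [oU Uh UA]] : exists U,
    [/\ open U, U h & forall k, U k -> ltrans k A = ltrans h A].
  have : nbhs h [set k | ltrans k A = ltrans h A] by exact: near_ltrans.
  rewrite nbhsE => -[U [oU Uh] UA].
  by exists U.
have [k [Uk Dk]] : U `&` D !=set0 by apply: dD => //; exists h.
by exists k => //; exact: UA.
Qed.

(** Each instance of an axiom of a mean concerns finitely many sets with open stabilizer. These lie
    in [U]-almost every family [I], so the axiom holds for [M I] there and passes to the limit. *)
Lemma cantor_invariant_mean : exists m : set G -> R, invariant_mean m.
Proof.
have /choice[M MP] : forall I : set (set G),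
    exists m : set G -> R, mean_family I -> invariant_mean_on I m.
  move=> I; have [/mean_family_mean[m mP]|nI] := pselect (mean_family I).
    by exists m.
  by exists (fun=> 0).
pose above (I : set (set G)) := [set J | mean_family J /\ I `<=` J].
pose F : set_system (set (set G)) := filter_from mean_family above.
have [I0 fI0 _] := mean_family_ex (@open_stabT G).
have FF : ProperFilter F.
  apply: filter_from_proper; last by move=> I fI; exists I; split.
  apply: filter_from_filter; first by exists I0.
  move=> I J fI fJ; exists (I `|` J); first exact: mean_familyU.
  by move=> K [fK IJK]; split; split => // A ?; apply: IJK; [left|right].
have [U [UU FU]] := ultraFilterLemma FF.
have PU : ProperFilter U by exact: ultra_proper.
have near_fam A : open_stab A -> \forall I \near U, mean_family I /\ I A.
  move=> /mean_family_ex[I fI IA]; apply: FU; exists I => // J [fJ IJ].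
  by split => //; exact: IJ.
have near_mean A : open_stab A ->
    \forall I \near U, invariant_mean_on I (M I) /\ I A.
  by move=> /near_fam; apply: filterS => I [fI IA]; split => //; exact: MP.
(* The limit exists for every [A], even without open stabilizer, because almost all [M I] take
   values in the compact interval [[0, 1]]. *)
have lim_ex A : exists l : R, M ^~ A @ U --> l.
  have : compact `[0, 1 : R] by exact: segment_compact.
  rewrite compact_ultra => /(_ (M ^~ A @ U))[].
  - exact: ultra_fmap.
  - have := near_mean _ (@open_stabT G); apply: filterS => I [[_ m01 _ _] _].
    by rewrite /= in_itv/=; exact: m01.
  - by move=> l [_ Ml]; exists l.
have [m mlim] := choice lim_ex.
exists m; split.
- apply: (cvg_unique (@Rhausdorff R) (mlim setT)); apply: cvg_near_cst.
  by have := near_mean _ (@open_stabT G); apply: filterS => I [[]].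
- move=> A; apply: (closed_cvg (fun x : R => 0 <= x)) (mlim A).
    exact: closed_ge.
  have := near_mean _ (@open_stabT G); apply: filterS => I [[_ m01 _ _] _].
  by have /andP[] := m01 A.
- move=> A B oA oB AB.
  apply: (cvg_unique (@Rhausdorff R) (mlim (A `|` B))).
  apply: cvg_trans (cvgD (mlim A) (mlim B)); apply: near_eq_cvg.
  near=> I; have [[_ _ mU _] IAB] : invariant_mean_on I (M I) /\ I (A `|` B).
    by near: I; exact/near_mean/open_stabU.
  rewrite mU//; [by near: I; apply: filterS (near_mean _ oA) => I' []|].
  by near: I; apply: filterS (near_mean _ oB) => I' [].
- move=> h A oA; apply: (cvg_unique (@Rhausdorff R) (mlim (ltrans h A))).
  apply: cvg_trans (mlim A); apply: near_eq_cvg.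
  by have := near_mean _ oA; apply: filterS => I [[_ _ _ mt] IA]; rewrite mt.
Unshelve. all: by end_near. Qed.

End mean_of_cantor.

Theorem mainTheorem2 (R : realType) (G : topologicalGroupType)
    (polishG : polish R G) (nonarchG : non_archimedean G) :
  amenable R G <->
  (forall act : G -> cantor_space -> cantor_space, continuous_action act ->
     exists mu : probability (borel cantor_space) R, invariant_measure act mu).
Proof.
split=> [amG act actP|cantorP X act cX hX actP].
  have [mu [_ muP]] := amG cantor_space act cantor_space_compact
    cantor_space_hausdorff actP.
  by exists mu.
have [sepG _] := polishG.
have [m mP] := cantor_invariant_mean sepG cantorP.
exact: (invariant_mean_measure mP).
Qed.
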